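(* Let $\mathcal H$ be a real Hilbert space, let $\varepsilon\in\left]0,1/2\right[$, let $m\geq 2$ be an integer, let $x_0\in\mathcal H$, and define $$\phi\colon\left]0,1\right[^m\to\left]0,1\right[\colon(\alpha_1,\ldots,\alpha_m)\mapsto\dfrac{1}{1+\dfrac{1}{\sum_{i=1}^m\dfrac{\alpha_i}{1-\alpha_i}}}.$$ For every $i\in\{1,\ldots,m\}$ and every $n\in\mathbb N$, let $\alpha_{i,n}\in\left]0,1\right[$, let $T_{i,n}\colon\mathcal H\to\mathcal H$ be $\alpha_{i,n}$-averaged, and let $e_{i,n}\in\mathcal H$. For every $n\in\mathbb N$, let $\lambda_n\in\left]0,(1-\varepsilon)(1+\varepsilon\phi(\alpha_{1,n},\ldots,\alpha_{m,n}))/\phi(\alpha_{1,n},\ldots,\alpha_{m,n})\right]$ and set $$x_{n+1}=x_n+\lambda_n\Big(T_{1,n}\Big(T_{2,n}\big(\cdots T_{m-1,n}(T_{m,n}x_n+e_{m,n})+e_{m-1,n}\cdots\big)+e_{2,n}\Big)+e_{1,n}-x_n\Big).$$ Suppose that $S=\bigcap_{n\in\mathbb N}\mathrm{Fix}(T_{1,n}\cdots T_{m,n})\neq\varnothing$ and that $\sum_{n\in\mathbb N}\lambda_n\|e_{i,n}\|<+\infty$ for every $i\in\{1,\ldots,m\}$. For every $i\in\{1,\ldots,m\}$ and $n\in\mathbb N$, define $T_{i+,n}=T_{i+1,n}\cdots T_{m,n}$ if $i\neq m$ and $T_{m+,n}=\mathrm{Id}$. Then: (i) $\sum_{n\in\mathbb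 N}\lambda_n\big(1/\phi(\alpha_{1,n},\ldots,\alpha_{m,n})-\lambda_n\big)\|T_{1,n}\cdots T_{m,n}x_n-x_n\|^2<+\infty$. (ii) For every $x\in S$, $\max_{1\leq i\leq m}\sum_{n\in\mathbb N}\dfrac{\lambda_n(1-\alpha_{i,n})}{\alpha_{i,n}}\big\|(\mathrm{Id}-T_{i,n})T_{i+,n}x_{n}-(\mathrm{Id}-T_{i,n})T_{i+,n}x\big\|^2<+\infty$. (iii) $(x_n)_{n\in\mathbb N}$ converges weakly to a point in $S$ if and only if every weak sequential cluster point of $(x_n)_{n\in\mathbb N}$ is in $S$. In this case, the convergence is strong if $\mathrm{int}\,S\neq\varnothing$. (iv) $(x_n)_{n\in\mathbb N}$ converges strongly to a point in $S$ if and only if $\liminf_{n\to\infty} d_S(x_n)=0$.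
   Context: An operator $T\colon\mathcal H\to\mathcal H$ is nonexpansive if it is 1-Lipschitz; for $\alpha\in\left]0,1\right[$, a nonexpansive $T$ is $\alpha$-averaged if there exists a nonexpansive $R\colon\mathcal H\to\mathcal H$ with $T=(1-\alpha)\mathrm{Id}+\alpha R$. $\mathrm{Fix}$ denotes the fixed point set, $d_S$ the distance function to $S$, $\mathrm{int}\,S$ the interior of $S$. *)

(* Defs.v *)
From HB Require Import structures.
From mathcomp Require Import all_boot all_order all_algebra.
From mathcomp Require Import all_classical all_reals all_analysis.
Set Implicit Arguments. Unset Strict Implicit. Unset Printing Implicit Defensive.
Import Order.TTheory GRing.Theory Num.Theory.
Import numFieldNormedType.Exports.
Local Open Scope classical_set_scope.
Local Open Scope ring_scope.

(* A real Hilbert space: a complete normed space H whose norm is induced by a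
   (symmetric, bilinear) inner product [ip]. *)
Definition is_inner_product {R : realType} {H : normedModType R}
  (ip : H -> H -> R) : Prop :=
  [/\ (forall x y, ip x y = ip y x),
      (forall a x y z, ip (a *: x + y) z = a * ip x z + ip y z)
    & (forall x, ip x x = `|x| ^+ 2)].

Section ops.
Context {R : realType} {H : normedModType R}.

Definition nonexpansive (T : H -> H) : Prop :=
  forall x y, `|T x - T y| <= `|x - y|.

Definition averaged (alpha : R) (T : H -> H) : Prop :=
  nonexpansive T /\
  exists Rop : H -> H, nonexpansive Rop /\
    forall x, T x = (1 - alpha) *: x + alpha *: Rop x.

Definition Fix (T : H -> H) : set H := [set x | T x = x].

Fixpoint compseg (T : nat -> H -> H) (i k : nat) : H -> H :=
  match k with
  | 0 => id
  | k'.+1 => T i \o compseg T i.+1 k'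
  end.

Fixpoint pchain (T : nat -> H -> H) (e : nat -> H) (i k : nat) (x : H) : H :=
  match k with
  | 0 => x
  | k'.+1 => T i (pchain T e i.+1 k' x) + e i
  end.

Definition dist_set (S : set H) (x : H) : R := inf [set `|x - s| | s in S].

Definition weak_cvg (ip : H -> H -> R) (u : nat -> H) (x : H) : Prop :=
  forall y, (fun n => ip (u n) y) @ \oo --> ip x y.

Definition weak_seq_cluster (ip : H -> H -> R) (u : nat -> H) (x : H) : Prop :=
  exists s : nat -> nat, (forall n, (s n < s n.+1)%N) /\ weak_cvg ip (u \o s) x.
End ops.

Definition phi {R : realType} (m : nat) (a : nat -> R) : R :=
  1 / (1 + 1 / (\sum_(1 <= i < m.+1) a i / (1 - a i))).

(* Main.v *)
Require Import Defs.
From HB Require Import structures.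
From mathcomp Require Import all_boot all_order all_algebra.
From mathcomp Require Import all_classical all_reals all_analysis.
From mathcomp Require Import ring lra.
Set Implicit Arguments.
Unset Strict Implicit.
Unset Printing Implicit Defensive.
Import Order.TTheory GRing.Theory Num.Theory.
Import numFieldNormedType.Exports.
Local Open Scope classical_set_scope.
Local Open Scope ring_scope.

(* Averagedness of T_i bounds |T_i u - T_i v|^2 by |u - v|^2 minus a multiple
   of the squared defect |(Id - T_i) u - (Id - T_i) v|^2.  Summing along the
   composition and applying Cauchy-Schwarz with weights alpha_i / (1 - alpha_i)
   shows that T_1 ... T_m is phi-averaged.  Hence, for z in S,
     |x_(n+1) - z| <= |x_n - z| + lambda_n sum_i |e_(i,n)|,
   and squaring gives (i); since lambda_n - 1 <= (1/phi - lambda_n) / eps,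
   (i) yields (ii).  Items (iii) and (iv) hold for every such quasi-Fejer
   sequence.  In (iii), Riesz representation gives x_n a weak limit along any
   ultrafilter; this limit is a weak sequential cluster point because an almost
   orthogonal subsequence of the differences can be extracted, and Opial's
   argument shows that the limits along all ultrafilters coincide. *)

(** * Inner-product identities and compositions of averaged operators *)

Section inner_product.
Context {R : realType} {H : normedModType R} (ip : H -> H -> R).
Hypothesis ipP : is_inner_product ip.
Implicit Types (x y z : H) (a : R).

Lemma ip_sym x y : ip x y = ip y x.
Proof. by case: ipP. Qed.

Lemma ip_norm x : ip x x = `|x| ^+ 2.
Proof. by case: ipP. Qed.

Lemma ip_linear a x y z : ip (a *: x + y) z = a * ip x z + ip y z.
Proof. by case: ipP. Qed.

Lemma ipDl x y z : ip (x + y) z = ip x z + ip y z.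
Proof. by rewrite -[x]scale1r ip_linear mul1r scale1r. Qed.

Lemma ip0l z : ip 0 z = 0.
Proof. by apply: (addrI (ip 0 z)); rewrite -ipDl !addr0. Qed.

Lemma ipZl a x z : ip (a *: x) z = a * ip x z.
Proof. by rewrite -[a *: x]addr0 ip_linear ip0l addr0. Qed.

Lemma ipNl x z : ip (- x) z = - ip x z.
Proof. by rewrite -scaleN1r ipZl mulN1r. Qed.

Lemma ipBl x y z : ip (x - y) z = ip x z - ip y z.
Proof. by rewrite ipDl ipNl. Qed.

Lemma ipDr x y z : ip z (x + y) = ip z x + ip z y.
Proof. by rewrite ip_sym ipDl !(ip_sym z). Qed.

Lemma ipZr a x z : ip z (a *: x) = a * ip z x.
Proof. by rewrite ip_sym ipZl (ip_sym z). Qed.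

Lemma ipNr x z : ip z (- x) = - ip z x.
Proof. by rewrite ip_sym ipNl (ip_sym z). Qed.

Lemma ipBr x y z : ip z (x - y) = ip z x - ip z y.
Proof. by rewrite ipDr ipNr. Qed.

Lemma normD2 x y : `|x + y| ^+ 2 = `|x| ^+ 2 + 2 * ip x y + `|y| ^+ 2.
Proof. by rewrite -!ip_norm !(ipDl, ipDr) (ip_sym y x); ring. Qed.

Lemma normB2 x y : `|x - y| ^+ 2 = `|x| ^+ 2 - 2 * ip x y + `|y| ^+ 2.
Proof. by rewrite normD2 ipNr normrN; ring. Qed.

Lemma norm_affine2 a x y : `|(1 - a) *: x + a *: y| ^+ 2 =
  (1 - a) * `|x| ^+ 2 + a * `|y| ^+ 2 - a * (1 - a) * `|x - y| ^+ 2.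
Proof.
by rewrite -!ip_norm !(ipDl, ipDr, ipZl, ipZr, ipNl, ipNr) (ip_sym y x); ring.
Qed.

(** Nonnegativity of the squared norm of [t *: x - ip x y *: y] at t = |y|^2, divided by |y|^2,
    gives the squared inequality. *)
Lemma cauchy_schwarz x y : `|ip x y| <= `|x| * `|y|.
Proof.
have [->|y0] := eqVneq y 0; first by rewrite ip_sym ip0l !normr0 mulr0.
have yp : 0 < `|y| ^+ 2 by rewrite exprn_gt0 ?normr_gt0.
have h t : 0 <= t * t * `|x| ^+ 2 - 2 * (t * ip x y) * ip x y
    + ip x y * ip x y * `|y| ^+ 2.
  have := sqr_ge0 `|t *: x - ip x y *: y|.
  rewrite -!ip_norm !(ipDl, ipDr, ipZl, ipZr, ipNl, ipNr) (ip_sym y x) !ip_norm.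
  by congr (_ <= _); ring.
rewrite -ler_sqr ?nnegrE ?mulr_ge0 // -normrX ger0_norm ?sqr_ge0 // exprMn.
rewrite -(ler_pM2l yp) -subr_ge0; apply: le_trans (h (`|y| ^+ 2)) _.
by rewrite le_eqVlt; apply/orP; left; apply/eqP; ring.
Qed.

(* (1 - a) / a |D|^2 equals a (1 - a) |u - v|^2 for D = a (u - v), the
   correction term of [norm_affine2]. *)
Lemma averaged_le (T : H -> H) a x y : 0 < a < 1 -> averaged a T ->
  `|T x - T y| ^+ 2 + (1 - a) / a * `|(x - T x) - (y - T y)| ^+ 2
  <= `|x - y| ^+ 2.
Proof.
move=> /andP[a0 a1] [_ [Q [Qne TQ]]].
have -> : T x - T y = (1 - a) *: (x - y) + a *: (Q x - Q y).
  by rewrite !TQ !scalerBr opprD addrACA.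
have -> : (x - T x) - (y - T y) = a *: ((x - y) - (Q x - Q y)).
  have TE v : v - T v = a *: (v - Q v).
    by rewrite TQ scalerBl scale1r scalerBr opprD opprB addrA [v + _]addrC subrK.
  by rewrite !TE -scalerBr !opprD !opprK addrACA.
rewrite norm_affine2 normrZ exprMn (gtr0_norm a0).
have h : `|Q x - Q y| ^+ 2 <= `|x - y| ^+ 2 by rewrite ler_sqr ?nnegrE.
set p := `|x - y| ^+ 2 in h *; set q := `|Q x - Q y| ^+ 2 in h *.
set r := `|_| ^+ 2.
have -> : (1 - a) * p + a * q - a * (1 - a) * r + (1 - a) / a * (a ^+ 2 * r) =
    (1 - a) * p + a * q by field; rewrite gt_eqF.
by nra.
Qed.

(** Induction on [r]: Cauchy-Schwarz bounds the cross term of |d_i + D|^2, and AM-GM splits it into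
    the mixed products of the right-hand side. *)
Lemma norm_sum_weighted (I : eqType) (r : seq I) (w : I -> R) (d : I -> H) :
  (forall i, i \in r -> 0 < w i) ->
  `|\sum_(i <- r) d i| ^+ 2 <=
  (\sum_(i <- r) w i) * (\sum_(i <- r) `|d i| ^+ 2 / w i).
Proof.
elim: r => [|i r IH] wp; first by rewrite !big_nil normr0 expr0n mul0r.
have wi : 0 < w i by apply: wp; rewrite mem_head.
have wr j : j \in r -> 0 < w j by move=> jr; apply: wp; rewrite in_cons jr orbT.
have {}IH := IH wr; rewrite !big_cons.
set D := \sum_(i <- r) d i in IH *; set W := \sum_(i <- r) w i in IH *.
set Q := \sum_(i <- r) _ in IH *.
have W0 : 0 <= W by rewrite /W big_seq sumr_ge0 // => j /wr /ltW.
have Q0 : 0 <= Q.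
  by rewrite /Q big_seq sumr_ge0 // => j /wr wj; rewrite divr_ge0 ?sqr_ge0 // ltW.
have p0 : 0 <= w i * Q by rewrite mulr_ge0 // ltW.
have q0 : 0 <= W * (`|d i| ^+ 2 / w i).
  by rewrite mulr_ge0 // divr_ge0 ?sqr_ge0 // ltW.
have amgm : 2 * ip (d i) D <= w i * Q + W * (`|d i| ^+ 2 / w i).
  apply: (@le_trans _ _ (2 * (`|d i| * `|D|))).
    by rewrite ler_pM2l //; apply: le_trans (ler_norm _) (cauchy_schwarz _ _).
  rewrite -ler_sqr ?nnegrE ?(addr_ge0 p0 q0) ?mulr_ge0 //.
  have pq : (w i * Q) * (W * (`|d i| ^+ 2 / w i)) = `|d i| ^+ 2 * (W * Q).
    by field; rewrite gt_eqF.
  have : `|d i| ^+ 2 * `|D| ^+ 2 <= `|d i| ^+ 2 * (W * Q).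
    by rewrite ler_wpM2l ?sqr_ge0.
  rewrite -pq.
  have := sqr_ge0 (w i * Q - W * (`|d i| ^+ 2 / w i)).
  set p := w i * Q; set q := W * _; nra.
have -> : (w i + W) * (`|d i| ^+ 2 / w i + Q) =
    `|d i| ^+ 2 + (w i * Q + W * (`|d i| ^+ 2 / w i)) + W * Q.
  by field; rewrite gt_eqF.
by rewrite normD2 !lerD.
Qed.

(** [i] and [k] enter only through [i + k], so removing the first factor of the segment leaves the
    later defects unchanged. *)
Definition defect (T : nat -> H -> H) i k x z j : H :=
  let c := compseg T j.+1 (i + k - j.+1) in
  (c x - T j (c x)) - (c z - T j (c z)).

(** Each half of a defect is a difference of consecutive intermediate points, so the sum
    telescopes. *)
Lemma sum_defect (T : nat -> H -> H) i k x z :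
  \sum_(i <= j < i + k) defect T i k x z j =
  (x - compseg T i k x) - (z - compseg T i k z).
Proof.
elim: k i => [|k IH] i; first by rewrite addn0 big_geq //= !subrr.
rewrite big_ltn ?addnS ?ltnS ?leq_addr // -addSn.
rewrite (eq_bigr (defect T i.+1 k x z)); last by move=> j _; rewrite /defect addSnnS.
rewrite IH /defect addnS subSS addnC addnK /=.
set c := compseg T i.+1 k.
by rewrite addrACA -opprD; congr (_ - _); rewrite addrC addrA subrK.
Qed.

(** [averaged_le] for the outermost factor is added to the induction hypothesis for the inner
    ones. *)
Lemma compseg_averaged_le (T : nat -> H -> H) (a : nat -> R) i k x z :
  (forall j, (i <= j < i + k)%N -> 0 < a j < 1 /\ averaged (a j) (T j)) ->
  `|compseg T i k x - compseg T i k z| ^+ 2 +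
  \sum_(i <= j < i + k) (1 - a j) / a j * `|defect T i k x z j| ^+ 2
  <= `|x - z| ^+ 2.
Proof.
elim: k i => [|k IH] i avg; first by rewrite addn0 big_geq // addr0.
rewrite big_ltn ?addnS ?ltnS ?leq_addr // -addSn.
rewrite (eq_bigr (fun j => (1 - a j) / a j * `|defect T i.+1 k x z j| ^+ 2));
  last by move=> j _; rewrite /defect addSnnS.
have [ai Ti] : 0 < a i < 1 /\ averaged (a i) (T i).
  by apply: avg; rewrite leqnn addnS ltnS leq_addr.
apply: le_trans (IH i.+1 _); last first.
  by move=> j /andP[ij jk]; apply: avg; rewrite (ltnW ij) -addSnnS.
rewrite addrA lerD2r.
rewrite {1}/defect addnS subSS addnC addnK /=.
exact: averaged_le.
Qed.

(** With weights [a j / (1 - a j)] in [norm_sum_weighted], the second factor is the loss term of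
    [compseg_averaged_le]. For the full composition the first factor equals phi / (1 - phi), which
    is how phi arises. *)
Lemma compseg_gap_le (T : nat -> H -> H) (a : nat -> R) i k x z :
  (forall j, (i <= j < i + k)%N -> 0 < a j < 1) ->
  `|(x - compseg T i k x) - (z - compseg T i k z)| ^+ 2 <=
  (\sum_(i <= j < i + k) a j / (1 - a j)) *
  \sum_(i <= j < i + k) (1 - a j) / a j * `|defect T i k x z j| ^+ 2.
Proof.
move=> a01; rewrite -sum_defect.
have -> : \sum_(i <= j < i + k) (1 - a j) / a j * `|defect T i k x z j| ^+ 2 =
    \sum_(i <= j < i + k) `|defect T i k x z j| ^+ 2 / (a j / (1 - a j)).
  by apply: eq_bigr => j _; rewrite invf_div mulrC.
apply: norm_sum_weighted => j; rewrite mem_index_iota => /a01 /andP[a0 a1].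
by rewrite divr_gt0 // subr_gt0.
Qed.

(** Each error is added outside its own operator and then passes only through nonexpansive outer
    ones, so it is never amplified. *)
Lemma pchain_compseg_le (T : nat -> H -> H) (e : nat -> H) i k x :
  (forall j, (i <= j < i + k)%N -> nonexpansive (T j)) ->
  `|pchain T e i k x - compseg T i k x| <= \sum_(i <= j < i + k) `|e j|.
Proof.
elim: k i => [|k IH] i ne; first by rewrite subrr normr0 sumr_ge0.
rewrite big_ltn ?addnS ?ltnS ?leq_addr // -addSn /= addrAC addrC.
apply: le_trans (ler_normD _ _) _; rewrite lerD2l.
apply: le_trans (ne i _ _ _) _; first by rewrite leqnn addnS ltnS leq_addr.
by apply: IH => j /andP[ij jk]; apply: ne; rewrite (ltnW ij) -addSnnS.
Qed.

End inner_product.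

(** * Summability of real sequences *)

Section bounded_sums.
Context {R : realType}.
Implicit Types a b c : nat -> R.

Definition bounded_sums a := exists M, forall n, \sum_(0 <= k < n) a k <= M.

Lemma nneseries_ltyP a : (forall n, 0 <= a n) ->
  (\sum_(0 <= n <oo) (a n)%:E < +oo)%E <-> bounded_sums a.
Proof.
move=> a0; split=> [|[M aM]].
  move=> fin; have ge0 : (0 <= \sum_(0 <= n <oo) (a n)%:E)%E.
    by apply: nneseries_ge0 => n _ _; rewrite lee_fin.
  exists (fine (\sum_(0 <= n <oo) (a n)%:E)%E) => n.
  rewrite -lee_fin fineK ?ge0_fin_numE // -sumEFin.
  by apply: nneseries_lim_ge => i _ _; rewrite lee_fin.
apply: (@le_lt_trans _ _ M%:E); last exact: ltry.
apply: lime_le; first by apply: is_cvg_nneseries => n _ _; rewrite lee_fin.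
by apply: nearW => n; rewrite sumEFin lee_fin.
Qed.

Lemma bounded_sumsD a b :
  bounded_sums a -> bounded_sums b -> bounded_sums (fun n => a n + b n).
Proof.
by move=> [M aM] [N bN]; exists (M + N) => n; rewrite big_split lerD.
Qed.

Lemma bounded_sumsZ r a : 0 <= r ->
  bounded_sums a -> bounded_sums (fun n => r * a n).
Proof.
by move=> r0 [M aM]; exists (r * M) => n; rewrite -mulr_sumr ler_wpM2l.
Qed.

Lemma bounded_sums_le a b :
  (forall n, a n <= b n) -> bounded_sums b -> bounded_sums a.
Proof.
by move=> ab [M bM]; exists M => n; apply: le_trans (bM n); apply: ler_sum.
Qed.

Lemma bounded_sums_sum (I : eqType) (r : seq I) (F : I -> nat -> R) :
  (forall i, i \in r -> bounded_sums (F i)) ->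
  bounded_sums (fun n => \sum_(i <- r) F i n).
Proof.
elim: r => [|i r IH] FM.
  by exists 0 => n; rewrite big1 // => k _; rewrite big_nil.
have Fi : bounded_sums (F i) by apply: FM; rewrite mem_head.
have {}IH : bounded_sums (fun n => \sum_(i <- r) F i n).
  by apply: IH => j jr; apply: FM; rewrite in_cons jr orbT.
have [M FM'] := bounded_sumsD Fi IH; exists M => n.
by under eq_bigr do rewrite big_cons; exact: FM'.
Qed.

(** Summation telescopes [a], and the last [a n] is dropped by nonnegativity. *)
Lemma bounded_sums_descent a b c : (forall n, 0 <= a n) ->
  (forall n, a n.+1 + b n <= a n + c n) -> bounded_sums c -> bounded_sums b.
Proof.
move=> a0 abc [M cM]; exists (a 0%N + M) => n.
apply: (@le_trans _ _ (a 0%N + \sum_(0 <= k < n) c k)); last by rewrite lerD2l.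
suff : a n + \sum_(0 <= k < n) b k <= a 0%N + \sum_(0 <= k < n) c k.
  by move: (a0 n); lra.
elim: n => [|n IH]; first by rewrite !big_geq.
by rewrite !big_nat_recr //=; move: IH (abc n); lra.
Qed.

Lemma bounded_sums_cvg a : (forall n, 0 <= a n) -> bounded_sums a ->
  cvgn (series a).
Proof.
move=> a0 [M aM]; apply: nondecreasing_is_cvgn.
  by apply: nondecreasing_series => n _ _; exact: a0.
by exists M => _ [n _ <-]; exact: aM.
Qed.

Lemma bounded_sums_tail a : (forall n, 0 <= a n) -> bounded_sums a ->
  forall d, 0 < d -> \forall N \near \oo, forall p,
    \sum_(N <= k < N + p) a k <= d.
Proof.
move=> a0 aM d d0; have cv := bounded_sums_cvg a0 aM.
have nd : nondecreasing_seq (series a).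
  by apply: nondecreasing_series => n _ _; exact: a0.
have /cvgrPdist_le/(_ d d0) := cv.
apply: filterS => N h p.
rewrite -(sub_series_geq a) ?leq_addr //.
have := nondecreasing_cvgn_le nd cv (N + p)%N.
have := ler_norm (limn (series a) - series a N).
by move: h; lra.
Qed.

End bounded_sums.

(** The centre [c] may vary with [d] and need not be a term of the sequence; in [fejer_cvgP] it is a
    point of [S]. *)
Lemma cauchy_tail_cvg {R : realType} {H : completeNormedModType R} (x : nat -> H) :
  (forall d : R, 0 < d -> exists N (c : H), forall p, `|x (N + p)%N - c| <= d) ->
  cvgn x.
Proof.
move=> xc; apply/cauchy_cvgP/cauchyP => d d0.
have [N [c hc]] := xc _ (divr_gt0 d0 (ltr0n _ 2)).
exists c; exists N => // n /= Nn; rewrite -ball_normE /= distrC.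
by rewrite -(subnKC Nn); apply: le_lt_trans (hc _) _; rewrite ltr_pdivrMr // ltr_pMr // ltr1n.
Qed.

(** * Riesz representation *)

Section weak_compactness.
Context {R : realType} {H : completeNormedModType R} (ip : H -> H -> R).
Hypothesis ipP : is_inner_product ip.

(* The minimising sequence [v] of [J] is Cauchy by the parallelogram identity,
   and near-minimality of [J (v k)] along the line through [v k] in direction
   [y] bounds [L y - ip (v k) y]. *)
Lemma riesz (L : H -> R) (M : R) :
  (forall a x y, L (a *: x + y) = a * L x + L y) ->
  (forall x, `|L x| <= M * `|x|) -> exists w, forall y, L y = ip w y.
Proof.
move=> Llin Lb.
pose J v := `|v| ^+ 2 - 2 * L v.
have Jlb v : - M ^+ 2 <= J v.
  have := le_trans (ler_norm _) (Lb v); have := sqr_ge0 (`|v| - M).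
  by rewrite /J; nra.
have infJ : has_inf (range J).
  by split; [exists (J 0), 0 | exists (- M ^+ 2) => _ [v _ <-]].
set j := inf (range J).
have jle v : j <= J v by apply: ge_inf; [exact: infJ.2|exists v].
have /choice[v Jv] : forall k : nat, exists u, J u < j + k.+1%:R^-1.
  move=> k; have [|_ [u _ <-] Ju] := @inf_adherent R _ k.+1%:R^-1 _ infJ.
    by rewrite invr_gt0.
  by exists u.
have line k t y : j <= J (v k) - 2 * t * (L y - ip (v k) y) + t ^+ 2 * `|y| ^+ 2.
  apply: le_trans (jle (t *: y + v k)) _.
  rewrite /J Llin addrC (normD2 ipP) (ipZl ipP) (ip_sym ipP) normrZ exprMn.
  by rewrite real_normK ?num_real //; lra.
(* [line] is used at [t = c / (Y + 1)]; the added 1 keeps the denominator positive when y = 0. *)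
have dir k y : (L y - ip (v k) y) ^+ 2 <= k.+1%:R^-1 * (`|y| ^+ 2 + 1).
  set c := L y - ip (v k) y; set Y := `|y| ^+ 2.
  have Y0 : 0 <= Y by exact: sqr_ge0.
  have Y1 : 0 < Y + 1 by lra.
  have := line k (c / (Y + 1)) y; rewrite -/c -/Y.
  have -> : J (v k) - 2 * (c / (Y + 1)) * c + (c / (Y + 1)) ^+ 2 * Y =
     J (v k) - c ^+ 2 / (Y + 1) - c ^+ 2 / (Y + 1) ^+ 2.
    by field; rewrite gt_eqF.
  have h0 : 0 <= c ^+ 2 / (Y + 1) ^+ 2 by rewrite divr_ge0 ?sqr_ge0.
  move=> h; rewrite -ler_pdivrMr //; move: h h0 (Jv k).
  by set A := _ / _; set A2 := _ / _; set K := k.+1%:R^-1; lra.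
(* At the midpoint, [J] is the mean of [J (v k)] and [J (v l)] minus |v k - v l|^2 / 4, and it is
   still at least [j]. *)
have close k l : `|v k - v l| ^+ 2 <= 2 * (k.+1%:R^-1 + l.+1%:R^-1).
  have := jle (2^-1 *: v k + 2^-1 *: v l).
  have e2 : (1 - 2^-1 : R) = 2^-1 by field.
  have L2 : L (2^-1 *: v k + 2^-1 *: v l) = 2^-1 * L (v k) + 2^-1 * L (v l).
    rewrite -[2^-1 *: v l]addr0 !Llin.
    have -> : L 0 = 0 by apply/eqP; rewrite -normr_eq0 eq_le normr_ge0
       (le_trans (Lb 0)) ?normr0 ?mulr0.
    by rewrite addr0.
  have := norm_affine2 ipP 2^-1 (v k) (v l); rewrite e2 => n2.
  rewrite /J n2 L2; move: (Jv k) (Jv l); rewrite /J.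
  by set p := k.+1%:R^-1; set q := l.+1%:R^-1; lra.
have cv : cvgn v.
  apply: cauchy_tail_cvg => d d0.
  have [N hN] : exists N : nat, N.+1%:R^-1 < d ^+ 2 / 4.
    have [N _ hN] := near_infty_natSinv_lt (PosNum (divr_gt0 (exprn_gt0 2 d0) (ltr0n R 4))).
    by exists N; apply: (hN N) => /=.
  exists N, (v N) => p.
  rewrite -ler_sqr ?nnegrE ?(ltW d0) //; apply: le_trans (close _ _) _.
  have : ((N + p).+1%:R^-1 : R) <= N.+1%:R^-1.
    by rewrite lef_pV2 ?posrE // ler_nat ltnS leq_addr.
  by move: hN; set r := N.+1%:R^-1; set q := (N + p)%N.+1%:R^-1; lra.
exists (limn v) => y; apply/eqP; rewrite -subr_eq0.
apply/negP => /negP ne0.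
set c := L y - ip (limn v) y in ne0.
pose B := `|y| ^+ 2 + 1.
have B0 : 0 < B by rewrite /B ltr_wpDl ?sqr_ge0.
have cp : 0 < c ^+ 2 by rewrite exprn_even_gt0.
(* For such [k], both [L y] and [ip (limn v) y] are closer than |c| / 2 to [ip (v k) y], although
   they differ by [c]. *)
have [k [k1 k2]] : exists k, k.+1%:R^-1 * B < c ^+ 2 / 4 /\
    `|limn v - v k| ^+ 2 * B < c ^+ 2 / 4.
  pose r := c ^+ 2 / 4 / B.
  have r0 : 0 < r by rewrite !divr_gt0.
  have m0 : 0 < Num.min 1 r / 2 by rewrite divr_gt0 // lt_min r0 ltr01.
  near \oo => k; exists k; split.
    rewrite -ltr_pdivlMr // -/r; near: k; exact: (near_infty_natSinv_lt (PosNum r0)).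
  rewrite -ltr_pdivlMr // -/r.
  have : `|limn v - v k| <= Num.min 1 r / 2.
    by near: k; move/cvgrPdist_le : cv; apply.
  have m1 : Num.min 1 r <= 1 by rewrite ge_min lexx.
  have m2 : Num.min 1 r <= r by rewrite ge_min lexx orbT.
  have := normr_ge0 (limn v - v k).
  by have := m0; nra.
have := dir k y; have := cauchy_schwarz ipP (limn v - v k) y.
rewrite (ipBl ipP) -/B => cs.
have cs2 : (ip (limn v) y - ip (v k) y) ^+ 2 <= `|limn v - v k| ^+ 2 * `|y| ^+ 2.
  by rewrite -exprMn -[X in X <= _]ger0_norm ?sqr_ge0 // normrX ler_sqr ?nnegrE ?mulr_ge0.
have : `|limn v - v k| ^+ 2 * `|y| ^+ 2 <= `|limn v - v k| ^+ 2 * B.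
  by rewrite ler_wpM2l ?sqr_ge0 // /B lerDl.
move=> h1 h2; have h3 : (ip (limn v) y - ip (v k) y) ^+ 2 < c ^+ 2 / 4.
  exact: le_lt_trans (le_trans cs2 h1) k2.
have h4 : (L y - ip (v k) y) ^+ 2 < c ^+ 2 / 4 by exact: le_lt_trans h2 k1.
have := sqr_ge0 ((L y - ip (v k) y) + (ip (limn v) y - ip (v k) y)).
by move: h3 h4; rewrite /c; set p := ip (limn v) y; set q := ip (v k) y; nra.
Unshelve. all: end_near. Qed.

End weak_compactness.

(** Compactness of [-M, M] provides a cluster point, and along an ultrafilter a cluster point is a
    limit. *)
Lemma ultra_bounded_cvg {R : realType} (U : set_system nat) (f : nat -> R) (M : R) :
  UltraFilter U -> (forall n, `|f n| <= M) -> exists l : R, f @ U --> l.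
Proof.
move=> UU fM; have UP : ProperFilter U by exact: ultra_proper.
have [|l [_ cl]] := @segment_compact R (- M) M (f @ U) _.
  apply: (@filterS _ U _ setT) filterT => n _ /=.
  by rewrite in_itv /= -ler_norml.
exists l => A Al.
have [//|UA] := in_ultra_setVsetC (f @^-1` A) UU.
by have [r [/= nAr Ar]] := cl (~` A) A UA Al.
Qed.

(** * Weak limits along ultrafilters and weak sequential cluster points *)

Section weak_cluster.
Context {R : realType} {H : completeNormedModType R} (ip : H -> H -> R).
Hypothesis ipP : is_inner_product ip.

(** The limits of [ip (u n) y] exist for all [y] along the same ultrafilter and form a bounded
    linear functional, which [riesz] represents. *)
Lemma ultra_weak_lim (U : set_system nat) (u : nat -> H) (M : R) :
  UltraFilter U -> (forall n, `|u n| <= M) ->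
  exists w, forall y, (fun n => ip (u n) y) @ U --> ip w y.
Proof.
move=> UU uM; have UP : ProperFilter U by exact: ultra_proper.
have uyM y n : `|ip (u n) y| <= M * `|y|.
  by apply: le_trans (cauchy_schwarz ipP _ _) _; rewrite ler_wpM2r.
have /choice[L LP] : forall y, exists l : R, (fun n => ip (u n) y) @ U --> l.
  by move=> y; exact: ultra_bounded_cvg (uyM y).
have [||w wL] := @riesz _ _ _ ipP L M.
- move=> a y z.
  have c : (fun n => ip (u n) (a *: y + z)) @ U --> a * L y + L z.
    have -> : (fun n => ip (u n) (a *: y + z)) =
        (fun n => a * ip (u n) y + ip (u n) z).
      by apply/funext => n; rewrite (ipDr ipP) (ipZr ipP).
    by apply: cvgD; [apply: cvgMr; exact: LP | exact: LP].
  by rewrite -(cvg_lim _ (LP (a *: y + z))) // (cvg_lim _ c).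
- move=> y; have : (fun n => `|ip (u n) y|) @ U --> `|L y| by exact: cvg_norm.
  move=> c; rewrite -(cvg_lim _ c) //; apply: limr_le; first by apply/cvg_ex; exists `|L y|.
  by apply: nearW => n; exact: uyM.
by exists w => y; rewrite -wL; exact: LP.
Qed.

Lemma geometric_half_bounded : bounded_sums (fun k => (2^-1 : R) ^+ k).
Proof.
exists 2 => n; suff : \sum_(0 <= k < n) (2^-1 : R) ^+ k = 2 - 2 * 2^-1 ^+ n.
  by move=> ->; rewrite gerBl mulr_ge0 ?exprn_ge0.
elim: n => [|n IH]; first by rewrite big_geq // expr0 mulr1 subrr.
by rewrite big_nat_recr //= IH exprS; field.
Qed.

(* Bessel's inequality up to summable errors: with [c k = ip (v k) y] and
   [S n] the n-th partial sum of [c k *: v k], the sum [A n] of the squares of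
   [c] equals [ip (S n) y], while [`|S n| ^+ 2] grows at most linearly in [A n]. *)
Lemma almost_orthogonal_weak0 (v : nat -> H) (M : R) :
  (forall k, `|v k| <= M) ->
  (forall j k, (j < k)%N -> `|ip (v j) (v k)| <= 2^-1 ^+ k / k.+1%:R) ->
  forall y, (fun k => ip (v k) y) @ \oo --> 0.
Proof.
move=> vM vo y; pose c k := ip (v k) y.
have M0 : 0 <= M by exact: le_trans (vM 0%N).
pose C := M * `|y|.
have C0 : 0 <= C by rewrite mulr_ge0.
have cC k : `|c k| <= C.
  by apply: le_trans (cauchy_schwarz ipP _ _) _; rewrite ler_wpM2r.
pose S n := \sum_(0 <= k < n) c k *: v k.
pose A n := \sum_(0 <= k < n) c k ^+ 2.
have SyA n : ip (S n) y = A n.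
  elim: n => [|n IH]; first by rewrite /S /A !big_geq // (ip0l ipP).
  by rewrite /S /A !big_nat_recr //= (ipDl ipP) (ipZl ipP) -/(S n) -/(A n) IH expr2.
(* Each of the n terms of [S n] contributes at most C 2^-n / (n + 1); the divisor [k.+1] in the
   hypothesis absorbs their number. *)
have Sv n : `|ip (S n) (v n)| <= C * 2^-1 ^+ n.
  have h m : (m <= n)%N -> `|ip (S m) (v n)| <= m%:R * (C * (2^-1 ^+ n / n.+1%:R)).
    elim: m => [|m IH] mn; first by rewrite /S big_geq // (ip0l ipP) normr0 mul0r.
    rewrite /S big_nat_recr //= (ipDl ipP) (ipZl ipP) -/(S m).
    apply: le_trans (ler_normD _ _) _; rewrite -natr1 mulrDl mul1r lerD ?IH 1?ltnW //.
    by rewrite normrM ler_pM // vo.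
  apply: le_trans (h n (leqnn n)) _.
  rewrite mulrCA ler_wpM2l // mulrA ler_pdivrMr // mulrC ler_wpM2l ?exprn_ge0 //.
  by rewrite ler_nat.
have [G gG] := geometric_half_bounded.
have S2 n : `|S n| ^+ 2 <= M ^+ 2 * A n + 2 * C ^+ 2 * G.
  apply: (@le_trans _ _ (M ^+ 2 * A n + 2 * C ^+ 2 * \sum_(0 <= k < n) 2^-1 ^+ k)).
    elim: n => [|n IH]; first by rewrite /S /A !big_geq // normr0 expr0n !mulr0 addr0.
    rewrite /S /A !big_nat_recr //= (normD2 ipP) -/(S n) -/(A n) (ipZr ipP) normrZ exprMn.
    rewrite real_normK ?num_real //.
    have h1 : c n * ip (S n) (v n) <= C * (C * 2^-1 ^+ n).
      by apply: le_trans (ler_norm _) _; rewrite normrM ler_pM.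
    have h2 : c n ^+ 2 * `|v n| ^+ 2 <= c n ^+ 2 * M ^+ 2.
      by rewrite ler_wpM2l ?sqr_ge0 // ler_sqr ?nnegrE.
    move: IH h1 h2; set g := \sum_(0 <= _ < _) _; set q := 2^-1 ^+ n.
    set p := c n * _; set p' := c n ^+ 2 * `|_| ^+ 2; nra.
  by rewrite lerD2l ler_wpM2l // mulr_ge0 // sqr_ge0.
have A0 n : 0 <= A n by apply: sumr_ge0 => k _; exact: sqr_ge0.
have G0 : 0 <= G by have := gG 0%N; rewrite big_geq.
pose K := M ^+ 2 + 2 * C ^+ 2 * G.
(* If A n > 1, then |S n|^2 <= K A n, and Cauchy-Schwarz for A n = [ip (S n) y] gives A n <= |y|^2
   K. The summand 1 covers the other case. *)
have AK n : A n <= 1 + `|y| ^+ 2 * K.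
  have K0 : 0 <= `|y| ^+ 2 * K.
    by rewrite mulr_ge0 ?sqr_ge0 // addr_ge0 ?sqr_ge0 // !mulr_ge0 ?sqr_ge0.
  have [A1|A1] := leP (A n) 1; first by rewrite (le_trans A1) // lerDl.
  have : A n ^+ 2 <= `|S n| ^+ 2 * `|y| ^+ 2.
    rewrite -exprMn ler_sqr ?nnegrE ?mulr_ge0 //.
    by rewrite -SyA; apply: le_trans (ler_norm _) (cauchy_schwarz ipP _ _).
  have : `|S n| ^+ 2 * `|y| ^+ 2 <= (K * A n) * `|y| ^+ 2.
    rewrite ler_wpM2r ?sqr_ge0 //; apply: le_trans (S2 n) _.
    rewrite /K (mulrDl (M ^+ 2)) lerD2l ler_peMr ?(ltW A1) //.
    by rewrite !mulr_ge0 ?sqr_ge0.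
  move=> h1 h2; have := le_trans h2 h1.
  rewrite expr2 mulrAC ler_pM2r ?(lt_trans _ A1) // mulrC => h.
  by rewrite (le_trans h) // lerDr.
have : (fun k => c k ^+ 2) @ \oo --> 0.
  apply: cvg_series_cvg_0; apply: bounded_sums_cvg => [k|]; first exact: sqr_ge0.
  by exists (1 + `|y| ^+ 2 * K).
move/cvgrPdist_le => c0; apply/cvgrPdist_le => d d0.
have := c0 (d ^+ 2) (exprn_gt0 _ d0); apply: filterS => k.
rewrite !sub0r !normrN normrX ler_sqr ?nnegrE //; exact: ltW.
Qed.

(** Along [U] the differences [v n] tend weakly to 0, so finitely many chosen indices always admit a
    later one whose [v] is almost orthogonal to theirs. Recursive choice yields a subsequence for
    [almost_orthogonal_weak0]. *)
Lemma ultra_weak_lim_cluster (U : set_system nat) (u : nat -> H) (M : R) (w : H) :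
  ProperFilter U -> \oo `<=` U -> (forall n, `|u n| <= M) ->
  (forall y, (fun n => ip (u n) y) @ U --> ip w y) -> weak_seq_cluster ip u w.
Proof.
move=> UP Uoo uM uw; pose v n := u n - w.
have v0 y (d : R) : 0 < d -> \forall n \near U, `|ip y (v n)| <= d.
  move=> d0; have /cvgrPdist_le/(_ d d0) := uw y.
  by apply: filterS => n; rewrite distrC -(ipBl ipP) (ip_sym ipP).
have step (ls : seq nat * nat) : exists n, forall j, j \in ls.1 ->
    (j < n)%N /\ `|ip (v j) (v n)| <= (2^-1 : R) ^+ ls.2 / ls.2.+1%:R.
  case: ls => l k /=.
  have d0 : 0 < (2^-1 : R) ^+ k / k.+1%:R by rewrite divr_gt0 ?exprn_gt0.
  suff : \forall n \near U, forall j, j \in l ->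
      (j < n)%N /\ `|ip (v j) (v n)| <= (2^-1 : R) ^+ k / k.+1%:R.
    by move/filter_ex.
  elim: l => [|i l IH]; first exact: nearW.
  have i1 : \forall n \near U, (i < n)%N by apply: Uoo; exact: nbhs_infty_gt.
  have i2 := v0 (v i) _ d0.
  near=> n => j; rewrite in_cons => /predU1P[->|jl].
    by split; near: n.
  by move: j jl; near: n.
have [g gP] := choice step.
(* [lst k] holds the first [k] chosen indices, latest first, since each choice depends on all
   previous ones. *)
pose fix lst k := if k is k'.+1 then g (lst k', k') :: lst k' else [::].
pose s k := g (lst k, k).
have slst j k : (j < k)%N -> s j \in lst k.
  elim: k => // k IH; rewrite ltnS leq_eqVlt => /predU1P[->|/IH h] /=.
    by rewrite in_cons eqxx.
  by rewrite in_cons h orbT.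
exists s; split=> [n|y]; first by apply: (gP (lst n.+1, n.+1) (s n) _).1; exact: slst.
have := @almost_orthogonal_weak0 (v \o s) (M + `|w|) _ _ y.
move=> vs; rewrite -[ip w y]add0r.
have -> : (fun n => ip ((u \o s) n) y) = (fun n => ip ((v \o s) n) y + ip w y).
  by apply/funext => n /=; rewrite /v (ipBl ipP) subrK.
apply: cvgD; last exact: cvg_cst.
apply: vs => [k|j k jk] /=.
  by rewrite (le_trans (ler_normB _ _)) // lerD2r.
exact: (gP (lst k, k) (s j) (slst _ _ jk)).2.
Unshelve. all: end_near. Qed.

End weak_cluster.

(** * Quasi-Fejer sequences *)

Section quasi_fejer.
Context {R : realType} {H : completeNormedModType R} (ip : H -> H -> R).
Hypothesis ipP : is_inner_product ip.
Variables (S : set H) (x : nat -> H) (eta : nat -> R).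
Hypothesis eta0 : forall n, 0 <= eta n.
Hypothesis eta_sum : bounded_sums eta.
Hypothesis fejer : forall z, S z -> forall n, `|x n.+1 - z| <= `|x n - z| + eta n.

Lemma fejer_tail z N p : S z ->
  `|x (N + p)%N - z| <= `|x N - z| + \sum_(N <= k < N + p) eta k.
Proof.
move=> Sz; elim: p => [|p IH]; first by rewrite addn0 big_geq // addr0.
rewrite addnS big_nat_recr ?leq_addr //= addrA.
by apply: le_trans (fejer Sz _) _; rewrite lerD2r.
Qed.

Lemma fejer_bounded z : S z -> exists B, forall n, `|x n - z| <= B.
Proof.
move=> Sz; have [M hM] := eta_sum; exists (`|x 0%N - z| + M) => n.
by rewrite -[n]add0n (le_trans (fejer_tail _ _ Sz)) // lerD2l add0n.
Qed.

(** Subtracting the partial sums of [eta] makes the distances nonincreasing and bounded below. *)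
Lemma fejer_norm_cvg z : S z -> cvgn (fun n => `|x n - z|).
Proof.
move=> Sz; have [M hM] := eta_sum.
have -> : (fun n => `|x n - z|) =
    (fun n => `|x n - z| - series eta n) \+ series eta.
  by apply/funext => n /=; rewrite subrK.
apply: is_cvgD; last exact: bounded_sums_cvg.
apply: nonincreasing_is_cvgn.
  apply/nonincreasing_seqP => n; rewrite seriesSr.
  by have := fejer Sz n; set t := series eta n; lra.
exists (- M) => _ [n _ <-]; rewrite -[- M]add0r lerB //.
exact: hM.
Qed.

(* Opial's argument: the difference of [`|x n - w| ^+ 2] and [`|x n - w'| ^+ 2]
   is affine in [ip (x n) (w - w')] and converges. *)
Lemma fejer_weak_lim_unique (U U' : set_system nat) w w' :
  ProperFilter U -> ProperFilter U' -> \oo `<=` U -> \oo `<=` U' ->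
  S w -> S w' ->
  (forall y, (fun n => ip (x n) y) @ U --> ip w y) ->
  (forall y, (fun n => ip (x n) y) @ U' --> ip w' y) -> w = w'.
Proof.
move=> UP U'P Uoo U'oo Sw Sw' cw cw'.
pose f n := `|x n - w'| ^+ 2 - `|x n - w| ^+ 2.
have /cvg_ex[l fl] : cvgn f.
  by apply: is_cvgB; apply: is_cvgM; exact: fejer_norm_cvg.
have fE n : f n = 2 * ip (x n) (w - w') + (`|w'| ^+ 2 - `|w| ^+ 2).
  by rewrite /f !(normB2 ipP) (ipBr ipP); ring.
(* Both filters refine [\oo], so the limit [l] of [f] can be computed along each; equating the two
   values gives |w - w'|^2 = 0. *)
have key (V : set_system nat) v : ProperFilter V -> \oo `<=` V ->
    (forall y, (fun n => ip (x n) y) @ V --> ip v y) ->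
    l = 2 * ip v (w - w') + (`|w'| ^+ 2 - `|w| ^+ 2).
  move=> VP Voo cv.
  have flV : f @ V --> l by move=> A Al; apply: Voo; exact: fl.
  rewrite -(cvg_lim _ flV) //; apply: cvg_lim => //.
  have -> : f = (fun n => 2 * ip (x n) (w - w') + (`|w'| ^+ 2 - `|w| ^+ 2)).
    exact/funext.
  by apply: cvgD; [apply: cvgMr; exact: cv | exact: cvg_cst].
have := key U w UP Uoo cw; rewrite (key U' w' U'P U'oo cw').
move=> h; apply/eqP; rewrite -subr_eq0 -normr_eq0 -sqrf_eq0 -(ip_norm ipP).
by rewrite {1}(ipBl ipP) subr_eq0; apply/eqP; lra.
Qed.

Lemma weak_lim_cluster w y : weak_cvg ip x w -> weak_seq_cluster ip x y -> y = w.
Proof.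
move=> xw [s [smono sy]].
have soo : s n @[n --> \oo] --> \oo.
  move=> A [N _ NA]; exists N => // n /= Nn; apply: NA => /=.
  apply: leq_trans Nn _; elim: n => // n IH.
  exact: leq_ltn_trans IH (smono n).
have h z : ip y z = ip w z.
  have c : (fun n => ip ((x \o s) n) z) @ \oo --> ip w z.
    exact: (cvg_comp _ _ soo (xw z)).
  by rewrite -(cvg_lim _ (sy z)) // (cvg_lim _ c).
by apply/eqP; rewrite -subr_eq0 -normr_eq0 -sqrf_eq0 -(ip_norm ipP) {1}(ipBl ipP) h subrr.
Qed.

Lemma fejer_weak_cvgP : S !=set0 ->
  (exists z, S z /\ weak_cvg ip x z) <->
  (forall y, weak_seq_cluster ip x y -> S y).
Proof.
move=> [z0 Sz0]; split=> [[z [Sz xz]] y xy|clS].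
  by rewrite (weak_lim_cluster xz xy).
have [B hB] := fejer_bounded Sz0.
have xM n : `|x n| <= B + `|z0|.
  by rewrite -[x n](subrK z0) (le_trans (ler_normD _ _)) // lerD2r.
have getlim (F : set_system nat) : ProperFilter F -> \oo `<=` F ->
    exists U w, [/\ ProperFilter U, F `<=` U, S w &
      forall y, (fun n => ip (x n) y) @ U --> ip w y].
  move=> FP Foo; have [U [UU FU]] := ultraFilterLemma FP.
  have UP : ProperFilter U by exact: ultra_proper.
  have [w Uw] := ultra_weak_lim ipP UU xM.
  exists U, w; split=> //; apply: clS; apply: ultra_weak_lim_cluster Uw => //.
  exact: subset_trans FU.
have [U [w [UP Uoo Sw Uw]]] := getlim \oo _ (@subset_refl _ _).
exists w; split=> // y; apply/cvgrPdist_le => d d0.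
apply: contrapT => nd.
(* If convergence fails at [y], then [A] is infinite and [\oo] restricted to [A] is proper. The weak
   limit along an ultrafilter refining it is again [w], which contradicts the choice of [A]. *)
pose A := [set n | d < `|ip w y - ip (x n) y|].
have AP : ProperFilter (within A \oo).
  apply: Build_ProperFilter_ex => B' [N _ NB].
  apply: contrapT => nB; apply: nd; exists N => // n /= Nn.
  by rewrite leNgt; apply/negP => An; apply: nB; exists n; apply: NB.
have ooA : \oo `<=` within A \oo.
  by move=> B' hB'; apply: filterS hB' => n Bn _.
have [U' [w' [U'P U'A Sw' U'w']]] := getlim (within A \oo) AP ooA.
have U'oo : \oo `<=` U' by exact: subset_trans U'A.
have U'A' : U' A by apply: U'A; exact: withinT.
have ww' := fejer_weak_lim_unique UP U'P Uoo U'oo Sw Sw' Uw U'w'.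
have /cvgrPdist_le/(_ d d0) h := U'w' y.
have [n [An]] := filter_ex (filterI U'A' h).
by rewrite /= -ww' leNgt An.
Qed.

Lemma norm_cvg_weak z : x @ \oo --> z -> weak_cvg ip x z.
Proof.
move=> xz y; apply/cvgrPdist_le => d d0.
have y1 : 0 < `|y| + 1 by rewrite ltr_wpDl.
have /cvgrPdist_le/(_ (d / (`|y| + 1)) (divr_gt0 d0 y1)) := xz.
apply: filterS => n; rewrite ler_pdivlMr // => h.
rewrite -(ipBl ipP); apply: le_trans (cauchy_schwarz ipP _ _) (le_trans _ h).
by rewrite ler_wpM2l // lerDl.
Qed.

(* Testing the Fejer inequality at [c - r u], with [u] the unit vector in the
   direction [x n.+1 - x n], bounds [2 r `|x n.+1 - x n|] by a telescoping
   term plus a summable one. *)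
Lemma fejer_interior_cvg : S° !=set0 -> cvgn x.
Proof.
move=> [c /nbhs_normP[r0 /= r00 rS]].
pose r := r0 / 2; have r_gt0 : 0 < r by rewrite divr_gt0.
have cS d : `|d| <= r -> S (c + d).
  move=> dr; apply: rS; rewrite /= opprD addrA subrr sub0r normrN.
  by apply: le_lt_trans dr _; rewrite /r ltr_pdivrMr // ltr_pMr // ltr1n.
have Sc : S c by rewrite -[c]addr0; apply: cS; rewrite normr0 ltW.
have [B hB] := fejer_bounded Sc.
have [M hM] := eta_sum.
have B0 : 0 <= B by exact: le_trans (hB 0%N).
have etaM n : eta n <= M.
  apply: le_trans (hM n.+1); rewrite big_nat_recr //= lerDr sumr_ge0 //.
have M0 : 0 <= M by exact: le_trans (etaM 0%N).
(* (p + eta)^2 - p^2 = eta (2 p + eta), with p <= B + r and eta <= M. *)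
pose K := 2 * (B + r) + M.
have desc n : `|x n.+1 - c| ^+ 2 + 2 * r * `|x n.+1 - x n| <=
    `|x n - c| ^+ 2 + K * eta n.
  pose D := x n.+1 - x n.
  pose u := if D == 0 then 0 else `|D|^-1 *: D.
  have uD : ip D u = `|D|.
    rewrite /u; case: eqVneq => [->|D0]; first by rewrite (ip0l ipP) normr0.
    by rewrite (ipZr ipP) (ip_norm ipP) expr2 mulrA mulVf ?mul1r // normr_eq0.
  have u1 : `|u| <= 1.
    rewrite /u; case: eqVneq => [_|D0]; first by rewrite normr0.
    by rewrite normrZ normfV normr_id mulVf // normr_eq0.
  have ru : `|r *: u| <= r by rewrite normrZ gtr0_norm // ler_piMr // ltW.
  have Ss : S (c - r *: u) by apply: cS; rewrite normrN.
  have := fejer Ss n.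
  have xE k : x k - (c - r *: u) = (x k - c) + r *: u by rewrite opprB addrCA addrC.
  rewrite !xE => h.
  have h2 : `|x n - c + r *: u| <= B + r.
    by rewrite (le_trans (ler_normD _ _)) // lerD.
  have h3 : `|x n.+1 - c + r *: u| ^+ 2 <= (`|x n - c + r *: u| + eta n) ^+ 2.
    by rewrite ler_sqr ?nnegrE ?addr_ge0.
  have h4 : (`|x n - c + r *: u| + eta n) ^+ 2 <= `|x n - c + r *: u| ^+ 2 + K * eta n.
    have := etaM n; have := eta0 n; rewrite /K.
    by move: h2; set p := `|_ + _|; set q := eta n; nra.
  have := le_trans h3 h4; rewrite !(normD2 ipP) !(ipZr ipP).
  have : ip (x n.+1 - c) u - ip (x n - c) u = `|D|.
    by rewrite -uD -(ipBl ipP) opprB addrA subrK.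
  by rewrite /D; move: r_gt0; nra.
have : bounded_sums (fun n => 2 * r * `|x n.+1 - x n|).
  apply: (@bounded_sums_descent _ (fun n => `|x n - c| ^+ 2) _ (fun n => K * eta n)).
  - by move=> n; exact: sqr_ge0.
  - exact: desc.
  by apply: bounded_sumsZ eta_sum; rewrite addr_ge0 // mulr_ge0 // addr_ge0 // ltW.
move=> /(bounded_sumsZ (ltW (_ : 0 < (2 * r)^-1))) sums.
have {sums} : bounded_sums (fun n => `|x n.+1 - x n|).
  have [|L hL] := sums; first by rewrite invr_gt0 mulr_gt0.
  exists L => n; apply: le_trans (hL n).
  rewrite le_eqVlt; apply/orP; left; apply/eqP; apply: eq_bigr => k _.
  by rewrite mulrA mulVf ?mul1r // gt_eqF // mulr_gt0.
move=> sums; apply: cauchy_tail_cvg => d d0.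
have [N _ /(_ N (leqnn _)) tailN] := bounded_sums_tail (fun n => normr_ge0 _) sums d0.
exists N, (x N) => p; apply: le_trans (tailN p).
elim: p => [|p IH]; first by rewrite addn0 subrr normr0 sumr_ge0.
rewrite addnS big_nat_recr ?leq_addr //=.
have -> : x (N + p).+1 - x N = (x (N + p)%N - x N) + (x (N + p).+1 - x (N + p)%N).
  by rewrite [RHS]addrC addrA subrK.
by apply: le_trans (ler_normD _ _) _; rewrite lerD2r.
Qed.

Lemma dist_set_ge0 (z : H) : 0 <= dist_set S z.
Proof.
rewrite /dist_set; have [->|ne] := eqVneq S set0; first by rewrite image_set0 inf0.
apply: lb_le_inf; first by move/set0P : ne => [s Ss]; exists `|z - s|, s.
by move=> _ [s _ <-].
Qed.

Lemma dist_set_le (z s : H) : S s -> dist_set S z <= `|z - s|.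
Proof.
by move=> Ss; apply: ge_inf; [exists 0 => _ [t _ <-] | exists s].
Qed.

(** The second premise is closedness of [S]. A vanishing liminf brings some late iterate near a
    point of [S], and the small error tail keeps all later iterates near that same point, so the
    sequence is Cauchy. *)
Lemma fejer_cvgP : S !=set0 ->
  (forall z, (forall d, 0 < d -> exists2 s, S s & `|z - s| <= d) -> S z) ->
  (exists z, S z /\ x @ \oo --> z) <->
  limn_einf (fun n => (dist_set S (x n))%:E) = 0%E.
Proof.
move=> [z0 Sz0] Scl; split=> [[z [Sz xz]]|liminf0].
  have c : (fun n => (dist_set S (x n))%:E) @ \oo --> 0%E.
    apply/cvg_EFin; first exact: nearW.
    apply/cvgrPdist_le => d d0; have /cvgrPdist_le/(_ d d0) := xz.
    apply: filterS => n h; rewrite /= sub0r normrN ger0_norm ?dist_set_ge0 //.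
    by apply: le_trans (dist_set_le _ Sz) _; rewrite distrC.
  by have [-> _] := cvg_limn_einf_sup c.
(* A third of [d] each goes to the distance from [x N] to [S], to the choice of [s] and to the error
   tail. *)
have near_S d : 0 < d -> exists N s, S s /\ forall p, `|x (N + p)%N - s| <= d.
  move=> d0; have d3 : 0 < d / 3 by rewrite divr_gt0.
  have [N0 _ tail] := bounded_sums_tail eta0 eta_sum d3.
  have : (einfs (fun n => (dist_set S (x n))%:E) N0 <= 0)%E.
    rewrite -liminf0 limn_einf_lim (cvg_lim _ (@cvg_einfs_sup _ _)) //.
    by apply: ereal_sup_ubound; exists N0.
  move=> infle.
  have [N N0N dN] : exists2 N, (N0 <= N)%N & dist_set S (x N) < d / 3.
    have lt3 : (einfs (fun n => (dist_set S (x n))%:E) N0 < (d / 3)%:E)%E.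
      by apply: le_lt_trans infle _; rewrite lte_fin.
    have [_ [N /= N0N <-]] := ereal_inf_lt lt3.
    by rewrite lte_fin => dN; exists N.
  have hi : has_inf [set `|x N - s| | s in S].
    by split; [exists `|x N - z0|, z0 | exists 0 => _ [t _ <-]].
  have [_ [s Ss <-] hs] := inf_adherent d3 hi.
  exists N, s; split=> // p; apply: le_trans (fejer_tail _ _ Ss) _.
  have := tail N N0N p; move: hs dN; rewrite /dist_set.
  by set i := inf _; set t := \sum_(_ <= _ < _) _; lra.
have cx : cvgn x.
  apply: cauchy_tail_cvg => d /near_S[N [s [_ h]]]; by exists N, s.
exists (limn x); split=> //; apply: Scl => d /near_S[N [s [Ss h]]].
exists s => //.
have c : (fun n => `|x n - s|) @ \oo --> `|limn x - s|.
  by apply: cvg_norm; apply: cvgB => //; exact: cvg_cst.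
rewrite -(cvg_lim _ c) //; apply: limr_le; first by apply/cvg_ex; eexists; exact: c.
by exists N => // n /= Nn; rewrite -(subnKC Nn).
Qed.

End quasi_fejer.

(** * Fixed-point sets, relaxed steps and the convergence theorem *)

Lemma compseg_nonexpansive {R : realType} {H : normedModType R}
    (T : nat -> H -> H) i k :
  (forall j, (i <= j < i + k)%N -> nonexpansive (T j)) ->
  nonexpansive (compseg T i k).
Proof.
elim: k i => [|k IH] i ne x y //=.
apply: le_trans (ne i _ _ _) _; first by rewrite leqnn addnS ltnS leq_addr.
by apply: IH => j /andP[ij jk]; apply: ne; rewrite (ltnW ij) -addSnnS.
Qed.

(** For every fixed point [s], nonexpansiveness gives |T z - z| <= 2 |z - s|. *)
Lemma Fix_adherent {R : realType} {H : normedModType R} (T : H -> H) z :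
  nonexpansive T ->
  (forall d : R, 0 < d -> exists2 s, Fix T s & `|z - s| <= d) -> Fix T z.
Proof.
move=> ne adh; apply/eqP; rewrite -subr_eq0 -normr_eq0 eq_le normr_ge0 andbT.
apply/ler_addgt0Pl => d d0; rewrite addr0.
have [s Ts zs] := adh _ (divr_gt0 d0 (ltr0n R 2)).
have -> : T z - z = (T z - T s) + (s - z) by rewrite Ts addrA subrK.
apply: le_trans (ler_normD _ _) _; rewrite (distrC s).
by have := ne z s; lra.
Qed.

(** The relaxed point is an affine combination with weights 1 - lam and lam, and [norm_affine2]
    remains valid for lam > 1. *)
Lemma relaxation_le {R : realType} {H : normedModType R} (ip : H -> H -> R)
    (lam q : R) (x t z : H) : is_inner_product ip -> 0 <= lam ->
  `|t - z| ^+ 2 + q <= `|x - z| ^+ 2 ->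
  `|x + lam *: (t - x) - z| ^+ 2 + lam * q <=
  `|x - z| ^+ 2 + lam * (lam - 1) * `|t - x| ^+ 2.
Proof.
move=> ipP lam0 h.
have -> : x + lam *: (t - x) - z = (1 - lam) *: (x - z) + lam *: (t - z).
  rewrite addrAC scalerBl scale1r -[RHS]addrA; congr (_ + _).
  by rewrite addrC -scalerBr opprB addrA subrK.
rewrite (norm_affine2 ipP) (distrC t x).
have -> : (x - z) - (t - z) = x - t by rewrite opprB addrA subrK.
by set p := `|x - z| ^+ 2 in h *; set s := `|t - z| ^+ 2 in h *; nra.
Qed.

(** [tau^-1] is (1 - phi) / phi, the coefficient of [averaged_le] for the whole composition. *)
Lemma inv_phi {R : realType} (m : nat) (a : nat -> R) : (0 < m)%N ->
  (forall i, (1 <= i <= m)%N -> 0 < a i < 1) ->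
  let tau := \sum_(1 <= i < m.+1) a i / (1 - a i) in
  0 < tau /\ 1 / phi m a = 1 + tau^-1.
Proof.
move=> m0 a01 tau; split; last by rewrite /phi !div1r invrK.
have pos i : (1 <= i <= m)%N -> 0 < a i / (1 - a i).
  by move=> /a01 /andP[? ?]; rewrite divr_gt0 // subr_gt0.
rewrite /tau big_ltn // ltr_pwDl ?pos // big_nat sumr_ge0 // => i /andP[i1 im].
by rewrite ltW // pos // (ltnW i1).
Qed.

Theorem theorem3p5 (R : realType) (H : completeNormedModType R)
  (ip : H -> H -> R) (eps : R) (m : nat) (x0 : H)
  (alpha : nat -> nat -> R) (T : nat -> nat -> H -> H) (e : nat -> nat -> H)
  (lambda : nat -> R) (x : nat -> H) :
  is_inner_product ip ->
  0 < eps < 1 / 2 ->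
  (2 <= m)%N ->
  (forall i n, (1 <= i <= m)%N -> 0 < alpha i n < 1) ->
  (forall i n, (1 <= i <= m)%N -> averaged (alpha i n) (T i n)) ->
  (forall n, 0 < lambda n <=
     (1 - eps) * (1 + eps * phi m (alpha^~ n)) / phi m (alpha^~ n)) ->
  x 0%N = x0 ->
  (forall n, x n.+1 =
     x n + lambda n *: (pchain (T^~ n) (e^~ n) 1 m (x n) - x n)) ->
  \bigcap_n Fix (compseg (T^~ n) 1 m) !=set0 ->
  (forall i, (1 <= i <= m)%N ->
     (\sum_(0 <= n <oo) (lambda n * `|e i n|)%:E < +oo)%E) ->
  let S := \bigcap_n Fix (compseg (T^~ n) 1 m) in
  let Tplus i n := compseg (T^~ n) i.+1 (m - i) in
  (* (i) *)
  (\sum_(0 <= n <oo)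
     (lambda n * (1 / phi m (alpha^~ n) - lambda n) *
      `|compseg (T^~ n) 1 m (x n) - x n| ^+ 2)%:E < +oo)%E /\
  (* (ii) *)
  (forall z, S z ->
     (\big[Order.max/-oo]_(1 <= i < m.+1)
        (\sum_(0 <= n <oo)
          (lambda n * (1 - alpha i n) / alpha i n *
           `|(Tplus i n (x n) - T i n (Tplus i n (x n)))
             - (Tplus i n z - T i n (Tplus i n z))| ^+ 2)%:E) < +oo)%E) /\
  (* (iii) *)
  ((exists z, S z /\ weak_cvg ip x z) <->
     (forall y, weak_seq_cluster ip x y -> S y)) /\
  (forall z, S z -> weak_cvg ip x z -> interior S !=set0 -> x @ \oo --> z) /\
  (* (iv) *)
  ((exists z, S z /\ x @ \oo --> z) <->
     limn_einf (fun n => (dist_set S (x n))%:E) = 0%E).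
Proof.
move=> ipP /andP[eps0 eps1] m2 a01 avg lamP _ xS [z0 Sz0] esum S Tplus.
have m0 : (0 < m)%N by exact: leq_trans m2.
have lam0 n : 0 < lambda n by have /andP[] := lamP n.
have rng j : (1 <= j < 1 + m)%N = (1 <= j <= m)%N by rewrite add1n ltnS.
have ne j n : (1 <= j < 1 + m)%N -> nonexpansive (T j n).
  by rewrite rng => /(avg _ n)[].
pose C n := compseg (T^~ n) 1 m.
have Cne n : nonexpansive (C n) by apply: compseg_nonexpansive => j /(ne _ n).
pose Q z n := \sum_(1 <= j < 1 + m)
  (1 - alpha j n) / alpha j n * `|defect (T^~ n) 1 m (x n) z j| ^+ 2.
pose P n := `|C n (x n) - x n| ^+ 2.
pose f n := 1 / phi m (alpha^~ n).
have Qi0 z n j : (1 <= j < 1 + m)%N ->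
    0 <= (1 - alpha j n) / alpha j n * `|defect (T^~ n) 1 m (x n) z j| ^+ 2.
  rewrite rng => /(a01 _ n)/andP[p0 p1].
  by rewrite mulr_ge0 ?sqr_ge0 // divr_ge0 ?(ltW p0) // subr_ge0 ltW.
have P0 n : 0 <= P n by exact: sqr_ge0.
have CQ z n : S z -> `|C n (x n) - z| ^+ 2 + Q z n <= `|x n - z| ^+ 2.
  move=> Sz; rewrite -[in C n (x n) - z](Sz n I).
  by apply: (compseg_averaged_le ipP) => j; rewrite rng => jm; split; [exact: a01|exact: avg].
have f1 n : 1 < f n.
  have [tau0 ftau] := inv_phi m0 (a01^~ n).
  by rewrite /f ftau ltrDl invr_gt0.
(* Together with [CQ] this is the averagedness inequality of [C n] with constant phi, at the fixed
   point [z]. *)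
have PQ z n : S z -> (f n - 1) * P n <= Q z n.
  move=> Sz; have [tau0 ftau] := inv_phi m0 (a01^~ n).
  rewrite /f ftau addrAC subrr add0r mulrC ler_pdivrMr // mulrC.
  have -> : P n = `|(x n - C n (x n)) - (z - C n z)| ^+ 2.
    by rewrite (Sz n I : C n z = z) subrr subr0 /P distrC.
  by apply: (compseg_gap_le ipP) => j; rewrite rng => /(a01 _ n).
have lamf n : lambda n <= (1 - eps) * (f n + eps).
  have /andP[_] := lamP n.
  have phi0 : phi m (alpha^~ n) != 0.
    by apply/eqP => p0; move: (f1 n); rewrite /f p0 invr0 mulr0 ltr10.
  by congr (_ <= _); rewrite /f; field.
(* f - (1 - eps) (f + eps) = eps (f - 1) + eps^2, and f > 1. *)
have flam n : eps ^+ 2 <= f n - lambda n by have := lamf n; have := f1 n; nra.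
(* Equivalent to (1 + eps) lambda <= f + eps, which holds since (1 - eps^2) (f + eps) <= f + eps. *)
have lam1 n : lambda n - 1 <= eps^-1 * (f n - lambda n).
  by rewrite mulrC ler_pdivlMr //; have := lamf n; have := f1 n; nra.
pose b n := lambda n * (f n - lambda n) * P n.
have b0 n : 0 <= b n.
  rewrite !mulr_ge0 ?(ltW (lam0 n)) //.
  by rewrite (le_trans _ (flam n)) // sqr_ge0.
pose E n := \sum_(1 <= j < 1 + m) `|e j n|.
pose eta n := lambda n * E n.
have eta0 n : 0 <= eta n by rewrite mulr_ge0 ?(ltW (lam0 n)) // sumr_ge0.
have eta_sum : bounded_sums eta.
  have [M hM] : bounded_sums (fun n => \sum_(1 <= j < 1 + m) lambda n * `|e j n|).
    apply: bounded_sums_sum => j; rewrite mem_index_iota rng => /esum h.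
    by apply/nneseries_ltyP => // n; rewrite mulr_ge0 // ltW.
  by exists M => n; under eq_bigr do rewrite /eta /E mulr_sumr; exact: hM.
(* The error-free step from [x n]; the actual iterate deviates from it by at most [eta n]. *)
pose y n := x n + lambda n *: (C n (x n) - x n).
have xy n : `|x n.+1 - y n| <= eta n.
  rewrite xS /y opprD addrACA subrr add0r -scalerBr opprB addrA subrK.
  rewrite normrZ gtr0_norm // ler_wpM2l ?(ltW (lam0 n)) //.
  by apply: pchain_compseg_le => j /(ne _ n).
(* [lam1] bounds the excess lambda (lambda - 1) P by [eps^-1 * b n], whose summability is (i). *)
have yQ z n : S z -> `|y n - z| ^+ 2 + lambda n * Q z n <=
    `|x n - z| ^+ 2 + eps^-1 * b n.
  move=> Sz; apply: le_trans (relaxation_le ipP (ltW (lam0 n)) (CQ z n Sz)) _.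
  have -> : eps^-1 * b n = lambda n * (eps^-1 * (f n - lambda n)) * P n.
    by rewrite /b; ring.
  by rewrite lerD2l ler_wpM2r // ler_wpM2l // ltW.
have yb z n : S z -> `|y n - z| ^+ 2 + b n <= `|x n - z| ^+ 2.
  move=> Sz; have := relaxation_le ipP (ltW (lam0 n)) (CQ z n Sz).
  rewrite -/(y n) -/(P n) /b.
  have : lambda n * ((f n - 1) * P n) <= lambda n * Q z n.
    by rewrite ler_wpM2l ?PQ // ltW.
  by lra.
have fejer z : S z -> forall n, `|x n.+1 - z| <= `|x n - z| + eta n.
  move=> Sz n; have -> : x n.+1 - z = (y n - z) + (x n.+1 - y n).
    by rewrite [RHS]addrC addrA subrK.
  apply: le_trans (ler_normD _ _) _; rewrite lerD //.
  rewrite -ler_sqr ?nnegrE //; apply: le_trans (yb z n Sz).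
  by rewrite lerDl.
have yx z : S z -> exists2 K, 0 <= K & forall n,
    `|x n.+1 - z| ^+ 2 <= `|y n - z| ^+ 2 + K * eta n.
  move=> Sz; have [B hB] := fejer_bounded eta_sum fejer Sz.
  have [M hM] := eta_sum.
  have etaM n : eta n <= M.
    by apply: le_trans (hM n.+1); rewrite big_nat_recr //= lerDr sumr_ge0.
  have B0 : 0 <= B by exact: le_trans (hB 0%N).
  have M0 : 0 <= M by exact: le_trans (etaM 0%N).
  (* (p + eta)^2 = p^2 + eta (2 p + eta), with p <= B and eta <= M. *)
  exists (2 * B + M); first by rewrite addr_ge0 // mulr_ge0.
  move=> n; have yB : `|y n - z| <= B.
    apply: le_trans (hB n); rewrite -ler_sqr ?nnegrE //.
    by apply: le_trans (yb z n Sz); rewrite lerDl.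
  have h : `|x n.+1 - z| <= `|y n - z| + eta n.
    have -> : x n.+1 - z = (y n - z) + (x n.+1 - y n).
      by rewrite [RHS]addrC addrA subrK.
    by apply: le_trans (ler_normD _ _) _; rewrite lerD2l.
  have h2 : `|x n.+1 - z| ^+ 2 <= (`|y n - z| + eta n) ^+ 2.
    by rewrite ler_sqr ?nnegrE ?addr_ge0.
  apply: le_trans h2 _.
  have := etaM n; have := eta0 n; move: yB.
  by set p := `|y n - z|; set q := eta n; nra.
have b_sum : bounded_sums b.
  have [K K0 hK] := yx z0 Sz0.
  apply: (@bounded_sums_descent _ (fun n => `|x n - z0| ^+ 2) _ (fun n => K * eta n)).
  - by move=> n; exact: sqr_ge0.
  - by move=> n; have := hK n; have := yb z0 n Sz0; lra.
  exact: bounded_sumsZ.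
have S0 : S !=set0 by exists z0.
split; first by apply/nneseries_ltyP.
split.
  move=> z Sz; rewrite big_seq.
  apply: (@big_ind _ (fun t : \bar R => (t < +oo)%E)) => [|u v u_fin v_fin|i]; first by [].
    by rewrite gt_max u_fin.
  rewrite mem_index_iota => im.
  have im' : (1 <= i <= m)%N by rewrite -rng.
  apply/nneseries_ltyP => [n|].
    by rewrite -(mulrA (lambda n)) -mulrA mulr_ge0 ?(ltW (lam0 n)) // (Qi0 z n i).
  have [K K0 hK] := yx z Sz.
  apply: (@bounded_sums_le _ _ (fun n => lambda n * Q z n)) => [n|].
    rewrite -(mulrA (lambda n)) -mulrA ler_wpM2l ?(ltW (lam0 n)) //.
    (* Since [1 + m - i.+1] reduces to [m - i], the term of (ii) is the i-th summand of [Q]; the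
       other summands are nonnegative. *)
    rewrite /Q (bigD1_seq i) ?mem_index_iota ?iota_uniq //= lerDl.
    rewrite big_seq_cond sumr_ge0 // => j /andP[]; rewrite mem_index_iota => jm _.
    exact: Qi0.
  apply: (@bounded_sums_descent _ (fun n => `|x n - z| ^+ 2) _
    (fun n => K * eta n + eps^-1 * b n)).
  - by move=> n; exact: sqr_ge0.
  - move=> n; have := hK n; have := yQ z n Sz.
    by set p := eps^-1 * b n; lra.
  apply: bounded_sumsD; first exact: bounded_sumsZ.
  by apply: bounded_sumsZ b_sum; rewrite invr_ge0 ltW.
split; first exact: (fejer_weak_cvgP ipP eta0 eta_sum fejer S0).
split.
  move=> z _ xz intS; have cx := fejer_interior_cvg ipP eta0 eta_sum fejer intS.
  (* The strong limit is also a weak limit, and [z] is a weak cluster point along the identity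
     subsequence. *)
  suff -> : z = limn x by [].
  apply: (weak_lim_cluster ipP (norm_cvg_weak ipP cx)).
  by exists id; split.
apply: (fejer_cvgP eta0 eta_sum fejer S0) => z adh n _.
apply: (Fix_adherent (Cne n)) => d /adh[s Ss zs].
by exists s => //; exact: Ss.
Qed.
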